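(* Let $s,m\in\mathbb N$, let $\mathcal I_m$ be the set of nonsingular $m\times m$ matrices over $\mathbb F_2$, and let generating matrices $\mathcal C_1,\dots,\mathcal C_s$ be drawn independently from the uniform distribution on $\mathcal I_m$. Consider random linear scrambling based on these generating matrices, and let $R_{m,r}$ ($r\in\mathbb N$) be its $r$-way rank deficiency (a random variable, being a function of $\mathcal C_1,\dots,\mathcal C_s$). Then $$\Pr\big(R_{m,1}\ge3s\log_2(m+1)\big)\le\frac{\exp(2s)}{(m+1)^{2s}},$$ and for every $r\ge2$, $$\Pr\Big(R_{m,r}\ge\max\big(R_{m,r-1},(2^r+2r-1)s\log_2(m+1)\big)\Big)\le\frac{\exp(2sr)}{(m+1)^{2sr}}.$$
   Context: Random linear scrambling with fixed generating matrices $\mathcal C_j\in\{0,1\}^{m\times m}$: $C_j=M_j\mathcal C_j\bmod2$, where $M_1,\dots,M_s\in\{0,1\}^{\infty\times m}$ are independent random lower-triangular matrices: $M_j(\ell,\ell)=1$ for $\ell\le m$, $M_j(\ell,\ell')=0$ for $\ell<\ell'$, and all entries with $\ell>\ell'$ i.i.d. uniform on $\{0,1\}$. For $k\in\mathbb N_0$, $k=\sum_{\ell\ge1}a_\ell2^{\ell-1}$, let $\kappa=\{\ell:a_\ell=1\}$; for $\boldsymbol k=(k_1,\dots,k_s)\in\mathbb N_0^s$ with digit sets $\kappa_1,\dots,\kappa_s$, $Z(\boldsymbol k)=\mathbf 1\{\sum_{j=1}^s\sum_{\ell\in\kappa_j}C_j(\ell,:)=\boldsymbol0\bmod2\}$.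 $\oplus$ on $\mathbb N_0^s$ is componentwise bitwise XOR, making $\mathbb N_0^s$ an $\mathbb F_2$-vector space; the rank of a finite subset is its $\mathbb F_2$-rank. With $\mathbb N_*^s=\mathbb N_0^s\setminus\{\boldsymbol0\}$ and $\mathbb V_r=\{V\subseteq\mathbb N_*^s:|V|=\mathrm{rank}(V)=r\}$, the $r$-way rank deficiency is $R_{m,r}=mr+\sup_{V\in\mathbb V_r}\log_2\Pr(Z(\boldsymbol k)=1\text{ for all }\boldsymbol k\in V\mid\mathcal C_1,\dots,\mathcal C_s)$, the probability being over the $M_j$. *)

(* Defs.v *)
From HB Require Import structures.
From mathcomp Require Import all_boot all_order all_algebra.
From mathcomp Require Import all_classical all_reals all_analysis.

Set Implicit Arguments.
Unset Strict Implicit.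
Unset Printing Implicit Defensive.

Import Order.TTheory GRing.Theory Num.Theory.
Local Open Scope ring_scope.

Definition vec (s : nat) := {ffun 'I_s -> nat}.

Definition zerov (s : nat) : vec s := [ffun _ => 0%N].

Definition xorv (s : nat) (u v : vec s) : vec s :=
  [ffun j => Nat.lxor (u j) (v j)].

Definition xor_seq (s : nat) (V : seq (vec s)) : vec s :=
  foldr (@xorv s) (zerov s) V.

Definition F2indep (s : nat) (V : seq (vec s)) : bool :=
  [forall S : {set 'I_(size V)},
    (#|S| != 0)%N ==> (xor_seq [seq nth (zerov s) V (val i) | i in S] != zerov s)].

Definition F2rank (s : nat) (V : seq (vec s)) : nat :=
  (\max_(S : {set 'I_(size V)} |
          F2indep [seq nth (zerov s) V (val i) | i in S]) #|S|)%N.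

Definition inVr (s r : nat) (V : seq (vec s)) : bool :=
  [&& uniq V, all (fun k => k != zerov s) V, size V == r & F2rank V == r].

(* finite (first L rows) marginal of the random scrambling matrix M_j:
   0-indexed: M(i,i) = 1 (for i < m), M(i,j) = 0 for i < j, others free *)
Definition lowtri (L m : nat) (M : 'M['F_2]_(L, m)) : bool :=
  [forall i : 'I_L, forall j : 'I_m,
     ((val i == val j) ==> (M i j == 1)) && ((val i < val j)%N ==> (M i j == 0))].

(* Z(k) = 1 for all k in V; bit i (0-indexed) of k_j is digit a_{i+1} *)
Definition Zall (s m L : nat) (Cg : {ffun 'I_s -> 'M['F_2]_m})
    (M : {ffun 'I_s -> 'M['F_2]_(L, m)}) (V : seq (vec s)) : bool :=
  all (fun k : vec s =>
         (\sum_(j < s) \sum_(i < L | Nat.testbit (k j) i) row i (M j *m Cg j))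
           == 0) V.

(* number of rows of M_j that matter for V: every digit of every entry
   of every k in V lies below this bound (since k < 2^k) *)
Definition bitbound (s m : nat) (V : seq (vec s)) : nat :=
  (m + \sum_(k <- V) \sum_(j < s) k j)%N.

Definition PZ (R : realType) (s m : nat) (Cg : {ffun 'I_s -> 'M['F_2]_m})
    (V : seq (vec s)) : R :=
  let L := bitbound m V in
  (#|[set M : {ffun 'I_s -> 'M['F_2]_(L, m)} |
        [forall j, lowtri (M j)] && Zall Cg M V]|%:R
   / #|[set M : {ffun 'I_s -> 'M['F_2]_(L, m)} | [forall j, lowtri (M j)]]|%:R).

Definition log2 (R : realType) (x : R) : R := ln x / ln 2.

Definition log2e (R : realType) (p : R) : \bar R :=
  if p == 0 then -oo%E else (log2 p)%:E.

Definition rank_def (R : realType) (s m r : nat)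
    (Cg : {ffun 'I_s -> 'M['F_2]_m}) : \bar R :=
  (((m * r)%N%:R : R)%:E
   + ereal_sup [set log2e (PZ R Cg V) | V in [set V : seq (vec s) | inVr r V]])%E.

Definition Prob (R : realType) (s m : nat)
    (E : pred {ffun 'I_s -> 'M['F_2]_m}) : R :=
  #|[set Cg : {ffun 'I_s -> 'M['F_2]_m} |
       [forall j, Cg j \in unitmx] && E Cg]|%:R
  / #|[set Cg : {ffun 'I_s -> 'M['F_2]_m} | [forall j, Cg j \in unitmx]]|%:R.

(* Main.v *)
Require Import Defs.
From HB Require Import structures.
From mathcomp Require Import all_boot all_order all_algebra.
From mathcomp Require Import all_classical all_reals all_analysis.
From mathcomp Require Import zify ring.
From Stdlib Require PeanoNat.
Import Order.TTheory GRing.Theory Num.Theory.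
Local Open Scope ring_scope.

Set Implicit Arguments.
Unset Strict Implicit.
Unset Printing Implicit Defensive.

(* Write the digits of the [j]th components of the vectors in [V] as the rows of
   a matrix [N j]; the event that [Z(k) = 1] on [V] is [\sum_j N j M_j C_j = 0].
   Scrambling rows below the [m]th are unconstrained, so the equations reduce to
   [r' <= r] independent ones involving [m] columns only, with the same value of
   [m r + log2 P]. The law of [M_j] is invariant under lower unitriangular
   matrices, and such column operations make the nonzero columns of each [N j]
   pairwise distinct, which leaves at most [(m+1) ^ (s (2 ^ r' - 1))] tuples
   [N]. For each of them the first moment over the generating matrices is at most
   [4 ^ s 2 ^ (- m r')], because uniform nonsingular matrices have density at
   most [4] with respect to uniform matrices. Markov's inequality and a union
   bound over [r'] and [N] give the claim for [r]. *)

(** * Linear systems over ['F_2] in tuples of matrices *)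

Lemma card_le_inj (T U : finType) (A : {set T}) (B : {set U}) (f : T -> U) :
  {in A, forall x, f x \in B} -> {in A &, injective f} -> (#|A| <= #|B|)%N.
Proof.
move=> fAB /card_in_imset <-; apply: subset_leq_card.
by apply/fintype.subsetP=> _ /imsetP[x xA ->]; exact: fAB.
Qed.

Lemma addrr_F2 (x : 'F_2) : x + x = 0.
Proof. by rewrite -mulr2n -mulr_natr pchar_Fp_0 ?mulr0. Qed.

Definition lincomb (s r p m : nat) (N : {ffun 'I_s -> 'M['F_2]_(r, p)})
    (X : {ffun 'I_s -> 'M['F_2]_(p, m)}) : 'M['F_2]_(r, m) :=
  \sum_j N j *m X j.

(* Linear independence of the rows of the block matrix [N_0 ... N_(s-1)]. *)
Definition rinvertible (s r p : nat) (N : {ffun 'I_s -> 'M['F_2]_(r, p)}) : bool :=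
  [exists D : {ffun 'I_s -> 'M['F_2]_(p, r)}, lincomb N D == 1%:M].

Definition scramblings (s L m : nat) : {set {ffun 'I_s -> 'M['F_2]_(L, m)}} :=
  [set M : {ffun 'I_s -> 'M['F_2]_(L, m)} | [forall j, lowtri (M j)]].

(** Its cardinality divided by that of [scramblings s L m] is the conditional probability, given
    [Cg], that the scrambled matrices solve the system with coefficients [N]. *)
Definition annihilating (s L m r : nat) (N : {ffun 'I_s -> 'M['F_2]_(r, L)})
    (Cg : {ffun 'I_s -> 'M['F_2]_m}) : {set {ffun 'I_s -> 'M['F_2]_(L, m)}} :=
  [set M in scramblings s L m | lincomb N [ffun j => M j *m Cg j] == 0].

Definition nonsingular (s m : nat) : {set {ffun 'I_s -> 'M['F_2]_m}} :=
  [set Cg : {ffun 'I_s -> 'M['F_2]_m} | [forall j, Cg j \in unitmx]].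

Lemma lincombD (s r p m : nat) (N : {ffun 'I_s -> 'M['F_2]_(r, p)})
    (X Y : {ffun 'I_s -> 'M['F_2]_(p, m)}) :
  lincomb N [ffun j => X j + Y j] = lincomb N X + lincomb N Y.
Proof.
rewrite /lincomb -big_split; apply: eq_bigr => j _.
by rewrite ffunE mulmxDr.
Qed.

Lemma lincombMr (s r p m q : nat) (N : {ffun 'I_s -> 'M['F_2]_(r, p)})
    (X : {ffun 'I_s -> 'M['F_2]_(p, m)}) (Z : 'M['F_2]_(m, q)) :
  lincomb N [ffun j => X j *m Z] = lincomb N X *m Z.
Proof.
by rewrite /lincomb mulmx_suml; apply: eq_bigr => j _; rewrite ffunE mulmxA.
Qed.

Lemma lincombMl (s r p m q : nat) (N : {ffun 'I_s -> 'M['F_2]_(r, p)})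
    (X : {ffun 'I_s -> 'M['F_2]_(p, m)}) (K : 'M['F_2]_(q, r)) :
  lincomb [ffun j => K *m N j] X = K *m lincomb N X.
Proof.
by rewrite /lincomb mulmx_sumr; apply: eq_bigr => j _; rewrite ffunE mulmxA.
Qed.

Lemma card_F2mx (m n : nat) : #|{: 'M['F_2]_(m, n)}| = (2 ^ (m * n))%N.
Proof. by rewrite card_mx card_Fp. Qed.

(* Translating a solution by [D j *m Z], where [D] is a right inverse of [N],
   moves it to the fibre over [Z]; distinct fibres are disjoint. *)
Lemma card_lincomb_kernel (s r p m : nat) (N : {ffun 'I_s -> 'M['F_2]_(r, p)}) :
  rinvertible N ->
  (#|[set X : {ffun 'I_s -> 'M['F_2]_(p, m)} | lincomb N X == 0%R]| * 2 ^ (r * m)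
     <= 2 ^ (p * m * s))%N.
Proof.
move=> /existsP[D /eqP ND1].
have -> : (2 ^ (p * m * s) = #|[set: {ffun 'I_s -> 'M['F_2]_(p, m)}]|)%N.
  by rewrite cardsT card_ffun card_ord card_F2mx expnM.
rewrite -card_F2mx -cardsT -cardsX.
pose f (u : {ffun 'I_s -> 'M['F_2]_(p, m)} * 'M['F_2]_(r, m)) :=
  [ffun j => u.1 j + [ffun k => D k *m u.2] j].
apply: (@card_le_inj _ _ _ _ f) => //.
move=> [X Z] [X' Z']; rewrite !inE /= !andbT => /eqP X0 /eqP X'0 e.
have eZ : Z = Z'.
  have := congr1 (lincomb N) e.
  by rewrite !lincombD X0 X'0 !lincombMr ND1 !mul1mx !add0r.
congr pair => //; apply/ffunP=> j; move/ffunP/(_ j): e.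
by rewrite eZ !ffunE => /addIr.
Qed.

(** * Unitriangular matrices and the first moment over the generating matrices *)

Lemma lowtriP (L m : nat) (M : 'M['F_2]_(L, m)) :
  reflect (forall (i : 'I_L) (j : 'I_m),
             (i = j :> nat -> M i j = 1) /\ ((i < j)%N -> M i j = 0))
          (lowtri M).
Proof.
apply: (iffP forallP) => [H i j|H i].
  have /forallP/(_ j)/andP[h1 h2] := H i.
  by split=> [/eqP/(implyP h1)/eqP|/(implyP h2)/eqP].
apply/forallP=> j; have [h1 h2] := H i j.
by apply/andP; split; apply/implyP; [move=> /eqP /h1 ->|move=> /h2 ->].
Qed.

Lemma lowtri_unitmx (m : nat) (M : 'M['F_2]_m) : lowtri M -> M \in unitmx.
Proof.
move=> /lowtriP H; rewrite unitmxE det_trig.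
  by rewrite (eq_bigr (fun=> 1)) ?big1_eq ?unitr1 // => i _; exact: (H i i).1.
by apply/is_trig_mxP=> i j; exact: (H i j).2.
Qed.

Lemma lowtri_mulmx (n m : nat) (A : 'M['F_2]_n) (M : 'M['F_2]_(n, m)) :
  lowtri A -> lowtri M -> lowtri (A *m M).
Proof.
move=> /lowtriP HA /lowtriP HM; apply/lowtriP=> i j; rewrite mxE; split=> ij.
  rewrite (bigD1 i) //= (HA i i).1 // (HM i j).1 // mul1r big1 ?addr0 // => k ki.
  have /orP[lt|gt] : (i < k)%N || (k < i)%N by rewrite -neq_ltn eq_sym.
    by rewrite (HA i k).2 // mul0r.
  by rewrite (HM k j).2 ?mulr0 // -ij.
rewrite big1 // => k _; case: (ltnP i k) => ik; first by rewrite (HA i k).2 // mul0r.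
by rewrite (HM k j).2 ?mulr0 // (leq_ltn_trans ik).
Qed.

(** After exchanging the two sums, a fixed square scrambling [M] acts injectively by left
    multiplication, so the nonsingular solutions embed in the kernel of [lincomb N], whose size is
    already bounded. *)
Lemma sum_annihilating (s m r : nat) (N : {ffun 'I_s -> 'M['F_2]_(r, m)}) :
  rinvertible N ->
  ((\sum_(Cg in nonsingular s m) #|annihilating N Cg|) * 2 ^ (r * m)
     <= #|scramblings s m m| * 2 ^ (m * m * s))%N.
Proof.
move=> Nr.
have -> : (\sum_(Cg in nonsingular s m) #|annihilating N Cg| =
  \sum_(M in scramblings s m m) #|[set Cg in nonsingular s m |
       lincomb N [ffun j => M j *m Cg j] == 0%R]|)%N.
  under eq_bigr do rewrite -sum1_card.
  under [RHS]eq_bigr do rewrite -sum1_card.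
  rewrite (exchange_big_dep [in scramblings s m m]) /=; last first.
    by move=> Cg M _; rewrite inE => /andP[].
  apply: eq_bigr => M Ms; apply: eq_bigl => Cg.
  by rewrite !inE; move: Ms; rewrite inE => ->.
rewrite big_distrl /= -sum_nat_const; apply: leq_sum => M.
rewrite inE => /forallP Ml.
apply: leq_trans (card_lincomb_kernel m Nr); rewrite leq_mul2r; apply/orP; right.
apply: (@card_le_inj _ _ _ _ (fun Cg : {ffun 'I_s -> 'M['F_2]_m} => [ffun j => M j *m Cg j])).
  by move=> Cg; rewrite !inE => /andP[].
move=> C C' _ _ /ffunP e; apply/ffunP=> j; have := e j; rewrite !ffunE.
exact: (can_inj (mulKmx (lowtri_unitmx (Ml j)))).
Qed.

Lemma card_scramblings_gt0 (s L m : nat) : (0 < #|scramblings s L m|)%N.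
Proof.
apply/card_gt0P; exists [ffun=> \matrix_(i, j) (i == j :> nat)%:R].
rewrite inE; apply/forallP=> j; rewrite ffunE; apply/lowtriP=> a b.
by rewrite mxE; split=> [->|/ltn_eqF ->]; rewrite ?eqxx.
Qed.

(** Markov's inequality with denominators cleared; [q] is a threshold for [2 ^ (m * r)] times the
    annihilation probability. *)
Lemma markov_annihilating (s m r q : nat) (N : {ffun 'I_s -> 'M['F_2]_(r, m)}) :
  rinvertible N ->
  (#|[set Cg in nonsingular s m |
       q * #|scramblings s m m| <= 2 ^ (m * r) * #|annihilating N Cg|]| * q
     <= 2 ^ (m * m * s))%N.
Proof.
move=> Nr; set B := [set _ in _ | _].
have S0 := card_scramblings_gt0 s m m.
rewrite -(leq_pmul2l S0); apply: leq_trans (sum_annihilating Nr).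
rewrite (mulnC (\sum_(_ in _) _)%N) mulnCA -sum_nat_const big_distrr /=.
rewrite [leqRHS](bigID [in B]) /=; apply: leq_trans (leq_addr _ _).
rewrite [leqRHS](eq_bigl [in B]); last by move=> Cg; rewrite !inE; case: [forall _, _].
rewrite mulnC (mulnC r); apply: leq_sum => Cg; by rewrite inE => /andP[].
Qed.

(** * Column operations that remove repeated nonzero columns *)

Definition distinct_cols (r m : nat) (N : 'M['F_2]_(r, m)) : bool :=
  [forall i, forall i', (col i N != 0) && (col i N == col i' N) ==> (i == i')].

(** [l] is the rightmost copy of column [i], strictly to its right, hence determined by [i]. *)
Definition last_dup (r m : nat) (N : 'M['F_2]_(r, m)) (l i : 'I_m) : bool :=
  [&& col i N != 0, (i < l)%N, col l N == col i N &
    [forall k : 'I_m, (l < k)%N ==> (col k N != col i N)]].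

(** Right multiplication adds to each nonzero column its rightmost later copy, which cancels it in
    characteristic 2, so that only the last of each group of equal nonzero columns survives. *)
Definition clear_dup (r m : nat) (N : 'M['F_2]_(r, m)) : 'M['F_2]_m :=
  1%:M + \matrix_(l, i) (last_dup N l i)%:R.

Lemma last_dup_inj (r m : nat) (N : 'M['F_2]_(r, m)) (l l' i : 'I_m) :
  last_dup N l i -> last_dup N l' i -> l = l'.
Proof.
move=> /and4P[_ _ cl /forallP/(_ l')/implyP h].
move=> /and4P[_ _ cl' /forallP/(_ l)/implyP h'].
apply/val_inj/eqP; rewrite eqn_leq leqNgt [X in _ && X]leqNgt.
by apply/andP; split; apply/negP; [move=> /h'|move=> /h]; rewrite ?(eqP cl) ?(eqP cl') eqxx.
Qed.

Lemma last_dup_exists (r m : nat) (N : 'M['F_2]_(r, m)) (i i' : 'I_m) :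
  col i N != 0 -> col i' N = col i N -> (i < i')%N -> exists l, last_dup N l i.
Proof.
move=> Ni0 /eqP e ii'; have [l /eqP cl lmax] := @arg_maxnP _ i'
  (fun l => col l N == col i N) (fun l : 'I_m => l : nat) e.
exists l; rewrite /last_dup Ni0 cl eqxx (leq_trans ii' (lmax _ e)) /=.
apply/forallP=> k; apply/implyP=> lk; apply/negP=> /lmax kl.
by have : (k <= l)%N by []; rewrite leqNgt lk.
Qed.

Lemma col_clear_dup (r m : nat) (N : 'M['F_2]_(r, m)) (i : 'I_m) :
  col i (N *m clear_dup N) = if [exists l, last_dup N l i] then 0 else col i N.
Proof.
have E a : (N *m clear_dup N) a i = N a i + \sum_l N a l * (last_dup N l i)%:R.
  rewrite mulmxDr mulmx1 mxE; congr (_ + _); rewrite mxE.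
  by apply: eq_bigr => l _; rewrite mxE.
apply/matrixP=> a b; rewrite mxE E; case: ifP => [/existsP[l li]|/existsP nl].
  rewrite (bigD1 l) //= li mulr1 big1 ?addr0; last first.
    move=> k kl; case kE: (last_dup N k i); rewrite ?mulr0 //.
    by rewrite (last_dup_inj kE li) eqxx in kl.
  move: li => /and4P[_ _ /eqP/matrixP/(_ a 0)]; rewrite !mxE => -> _.
  exact: addrr_F2.
rewrite big1 ?addr0 ?mxE // => l _.
by case: (boolP (last_dup N l i)) => [h|]; rewrite ?mulr0 //; case: nl; exists l.
Qed.

Lemma clear_dup_lowtri (r m : nat) (N : 'M['F_2]_(r, m)) : lowtri (clear_dup N).
Proof.
apply/lowtriP=> i j; rewrite !mxE /last_dup -val_eqE /=; split=> [->|ij].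
  by rewrite eqxx ltnn andbF addr0.
by rewrite (ltn_eqF ij) [(j < i)%N]ltnNge (ltnW ij) andbF addr0.
Qed.

(** The off-diagonal part squares to zero because a rightmost copy has no later copy, and its double
    vanishes in characteristic 2. *)
Lemma clear_dupK (r m : nat) (N : 'M['F_2]_(r, m)) :
  clear_dup N *m clear_dup N = 1%:M.
Proof.
rewrite /clear_dup; set E := (X in 1%:M + X).
have EE : E *m E = 0.
  apply/matrixP=> a i; rewrite !mxE big1 // => b _; rewrite !mxE.
  case: (boolP (last_dup N a b)) => [ab|]; rewrite ?mul0r // mul1r.
  case: (boolP (last_dup N b i)) => [bi|] //.
  case/and4P: ab => _ ab /eqP cab _; case/and4P: bi => _ _ /eqP cbi.
  by move=> /forallP/(_ a)/implyP/(_ ab); rewrite cab cbi eqxx.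
have E2 : E + E = 0.
  by apply/matrixP=> a i; rewrite mxE addrr_F2 mxE.
by rewrite mulmxDl mul1mx mulmxDr mulmx1 EE addr0 -addrA E2 addr0.
Qed.

Lemma clear_dup_distinct (r m : nat) (N : 'M['F_2]_(r, m)) :
  distinct_cols (N *m clear_dup N).
Proof.
apply/forallP=> i; apply/forallP=> i'; apply/implyP; rewrite !col_clear_dup.
case: ifPn => [_|/existsP li]; first by rewrite eqxx.
case: ifPn => [_|/existsP li'] /andP[Ni0 /eqP e]; first by rewrite e eqxx in Ni0.
rewrite -val_eqE eqn_leq leqNgt [X in _ && X]leqNgt.
apply/andP; split; apply/negP => h.
  by apply: li'; apply: last_dup_exists h; rewrite -?e.
by apply: li; apply: last_dup_exists h; rewrite -?e.
Qed.

(** As [clear_dup (N j)] is an involution, it can be inserted twice between [N j] and [M j]: one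
    factor clears the columns of [N j], the other maps scramblings injectively to scramblings. *)
Lemma annihilating_distinct (s m r : nat) (N : {ffun 'I_s -> 'M['F_2]_(r, m)})
    (Cg : {ffun 'I_s -> 'M['F_2]_m}) : rinvertible N ->
  exists N' : {ffun 'I_s -> 'M['F_2]_(r, m)},
    [/\ rinvertible N', forall j, distinct_cols (N' j) &
        (#|annihilating N Cg| <= #|annihilating N' Cg|)%N].
Proof.
move=> /existsP[D /eqP ND]; exists [ffun j => N j *m clear_dup (N j)].
have AA p (X : {ffun 'I_s -> 'M['F_2]_(m, p)}) :
    lincomb [ffun j => N j *m clear_dup (N j)] [ffun j => clear_dup (N j) *m X j]
    = lincomb N X.
  apply: eq_bigr => j _.
  by rewrite !ffunE mulmxA -(mulmxA (N j)) clear_dupK mulmx1.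
split=> [|j|].
- by apply/existsP; exists [ffun j => clear_dup (N j) *m D j]; rewrite AA ND.
- by rewrite ffunE clear_dup_distinct.
apply: (@card_le_inj _ _ _ _
  (fun M : {ffun 'I_s -> 'M['F_2]_(m, m)} => [ffun j => clear_dup (N j) *m M j])).
  move=> M; rewrite !inE => /andP[/forallP Ml /eqP M0]; apply/andP; split.
    by apply/forallP=> j; rewrite ffunE lowtri_mulmx // clear_dup_lowtri.
  rewrite -M0 -AA; apply/eqP; congr lincomb.
  by apply/ffunP=> j; rewrite !ffunE mulmxA.
move=> M M' _ _ /ffunP e; apply/ffunP=> j; have := e j; rewrite !ffunE.
exact: (can_inj (mulKmx (lowtri_unitmx (clear_dup_lowtri (N j))))).
Qed.

(* A tuple of matrices with distinct nonzero columns is determined by the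
   position, if any, of each nonzero column vector in each matrix. *)
Lemma card_distinct_cols (s m r : nat) :
  (#|[set N : {ffun 'I_s -> 'M['F_2]_(r, m)} | [forall j, distinct_cols (N j)]]|
     <= m.+1 ^ (s * (2 ^ r - 1)))%N.
Proof.
have -> : (m.+1 ^ (s * (2 ^ r - 1)) =
    #|[set: {ffun 'I_s * {c : 'cV['F_2]_r | c != 0%R} -> option 'I_m}]|)%N.
  rewrite cardsT card_ffun card_option card_ord card_prod card_ord card_sig.
  rewrite (eq_card (_ : _ =i predC1 (0 : 'cV['F_2]_r))) // cardC1.
  by rewrite card_F2mx muln1 subn1.
pose pos (N : {ffun 'I_s -> 'M['F_2]_(r, m)}) :=
  [ffun u : 'I_s * {c : 'cV['F_2]_r | c != 0} =>
    [pick i | col i (N u.1) == val u.2]].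
have half N N' j i : pos N = pos N' -> distinct_cols (N j) ->
    col i (N j) != 0 -> col i (N' j) = col i (N j).
  move=> /ffunP/(_ (j, _)) e Nd Ni0; have := e (Sub (col i (N j)) Ni0); rewrite !ffunE /=.
  case: pickP => [k /eqP ck|/(_ i)]; last by rewrite eqxx.
  have -> : k = i.
    apply/esym/eqP; have /forallP/(_ i)/forallP/(_ k)/implyP := Nd; apply.
    by rewrite Ni0 ck eqxx.
  by case: pickP => // k' /eqP ck' [ik']; rewrite {1}ik'.
apply: (@card_le_inj _ _ _ _ pos) => // N N'.
rewrite !inE => /forallP Nd /forallP Nd' e.
apply/ffunP=> j; apply/matrixP=> a i.
suff /matrixP/(_ a 0) : col i (N j) = col i (N' j) by rewrite !mxE.
(* A zero column leaves no trace in [pos]; if the other matrix has a nonzero column there, [half] is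
   applied in the opposite direction. *)
case: (eqVneq (col i (N j)) 0) => [Ni0|/(half _ _ _ _ e (Nd j))-> //].
case: (eqVneq (col i (N' j)) 0) => [->//|/(half _ _ _ _ (esym e) (Nd' j))-> //].
Qed.

(** * Truncation of the scramblings to their first [m] rows *)

(** With only [m] columns, every position on or above the diagonal lies in the top block. *)
Lemma lowtri_usubmx (m h : nat) (M : 'M['F_2]_(m + h, m)) :
  lowtri M = lowtri (usubmx M).
Proof.
apply/lowtriP/lowtriP => H i j; first by have := H (lshift h i) j; rewrite mxE.
case: (split_ordP i) => k ->; first by have := H k j; rewrite mxE.
by split=> /= kj; have := ltn_ord j; rewrite -?kj; lia.
Qed.

Lemma rinvertible_mxrow (s r p : nat) (N : {ffun 'I_s -> 'M['F_2]_(r, p)}) :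
  row_free (\mxrow_(j < s) N j) -> rinvertible N.
Proof.
move=> /row_freeP[D ND]; apply/existsP; exists [ffun j => submxcol D j].
rewrite -ND -[in X in _ == X](submxcolK D) mul_mxrow_mxcol; apply/eqP.
by apply: eq_bigr => j _; rewrite ffunE.
Qed.

Lemma card_scramblings_extend (s m h : nat) :
  (#|scramblings s m m| * 2 ^ (h * m * s) <= #|scramblings s (m + h) m|)%N.
Proof.
have -> : (2 ^ (h * m * s) = #|[set: {ffun 'I_s -> 'M['F_2]_(h, m)}]|)%N.
  by rewrite cardsT card_ffun card_ord card_F2mx expnM.
pose f (u : {ffun 'I_s -> 'M['F_2]_m} * {ffun 'I_s -> 'M['F_2]_(h, m)}) :=
  [ffun j => col_mx (u.1 j) (u.2 j)].
rewrite -cardsX; apply: (@card_le_inj _ _ _ _ f) => [[U W]|[U W] [U' W'] _ _ e].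
  rewrite !inE /= andbT => /forallP Ul; apply/forallP=> j.
  by rewrite ffunE lowtri_usubmx col_mxKu.
by congr pair; apply/ffunP=> j; move/ffunP/(_ j): e; rewrite !ffunE => /eq_col_mx[].
Qed.

Lemma rinvertible_left (s r q p : nat) (N : {ffun 'I_s -> 'M['F_2]_(r, p)})
    (K : 'M['F_2]_(q, r)) :
  row_free K -> rinvertible N -> rinvertible [ffun j => K *m N j].
Proof.
move=> /row_freeP[KD KK] /existsP[D /eqP ND]; apply/existsP.
by exists [ffun j => D j *m KD]; rewrite lincombMl lincombMr ND mul1mx KK.
Qed.

Lemma mulmx_split (r m h q : nat) (A : 'M['F_2]_(r, m + h))
    (X : 'M['F_2]_(m + h, q)) :
  A *m X = lsubmx A *m usubmx X + rsubmx A *m dsubmx X.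
Proof. by rewrite -{1}(hsubmxK A) -{1}(vsubmxK X) mul_row_col. Qed.

(* Rows of the scramblings below the [m]th are unconstrained, so each equation
   that involves them independently costs a factor [2 ^ m] exactly; only the
   combinations [K] of the equations that avoid them remain. *)
Lemma annihilating_truncate (s m h r : nat)
    (N : {ffun 'I_s -> 'M['F_2]_(r, m + h)}) (Cg : {ffun 'I_s -> 'M['F_2]_m}) :
  Cg \in nonsingular s m -> rinvertible N ->
  exists r' (N' : {ffun 'I_s -> 'M['F_2]_(r', m)}),
    [/\ (r' <= r)%N, rinvertible N' &
        (#|annihilating N Cg| * 2 ^ (m * r) * #|scramblings s m m|
           <= 2 ^ (m * r') * #|annihilating N' Cg| * #|scramblings s (m + h) m|)%N].
Proof.
rewrite inE => /forallP Cu Nr.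
(* [H] collects the coefficients of the rows below the [m]th; the rows of [K] form a basis of the
   combinations of equations in which these coefficients cancel. *)
pose H := \mxrow_(j < s) rsubmx (N j); pose K := row_base (kermx H).
have KH j : K *m rsubmx (N j) = 0.
  have KH0 : K *m H = 0 by apply/sub_kermxP; rewrite eq_row_base.
  move/(congr1 (fun A => submxrow A j)): KH0; rewrite mul_mxrow mxrowK => ->.
  by apply/matrixP=> a b; rewrite !mxE.
have KN p (X : {ffun 'I_s -> 'M['F_2]_(m + h, p)}) :
    lincomb [ffun j => K *m N j] X =
    lincomb [ffun j => K *m lsubmx (N j)] [ffun j => usubmx (X j)].
  apply: eq_bigr => j _.
  by rewrite !ffunE -mulmxA mulmx_split mulmxDr !mulmxA KH mul0mx addr0.
have KNr : rinvertible [ffun j => K *m lsubmx (N j)].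
  have /existsP[D] := rinvertible_left (row_base_free (kermx H)) Nr.
  by rewrite -/K KN => ?; apply/existsP; exists [ffun j => usubmx (D j)].
exists (\rank (kermx H)), [ffun j => K *m lsubmx (N j)]; split=> //.
  by rewrite mxrank_ker leq_subr.
set A1 := annihilating [ffun j => K *m N j] Cg.
have step1 : (#|annihilating N Cg| * 2 ^ (\rank H * m) <= #|A1|)%N.
  have /submxP[E EH] : (row_base H <= H)%MS by rewrite eq_row_base.
  have /row_freeP[D0 D0E] := row_base_free H.
  pose D := [ffun j => submxcol D0 j] : {ffun 'I_s -> 'M['F_2]_(h, \rank H)}.
  have ED : E *m (\sum_j rsubmx (N j) *m D j) = 1%:M.
    rewrite -D0E EH -mulmxA -[in RHS](submxcolK D0) mul_mxrow_mxcol; congr (_ *m _).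
    by apply: eq_bigr => j _; rewrite ffunE.
  (* Only the free rows are shifted, and [invmx (Cg j)] cancels the generating matrix. The system
     then changes by a term that [K] annihilates and from which [E] recovers [Z]. *)
  pose f (u : {ffun 'I_s -> 'M['F_2]_(m + h, m)} * 'M['F_2]_(\rank H, m)) :=
    [ffun j => u.1 j + col_mx 0 (D j *m u.2 *m invmx (Cg j))].
  have fN (u : {ffun 'I_s -> 'M['F_2]_(m + h, m)} * 'M['F_2]_(\rank H, m)) :
     lincomb N [ffun j => f u j *m Cg j] = lincomb N [ffun j => u.1 j *m Cg j] +
       (\sum_j rsubmx (N j) *m D j) *m u.2.
    rewrite mulmx_suml -big_split; apply: eq_bigr => j _.
    rewrite !ffunE mulmxDl mulmxDr mul_col_mx mul0mx mulmxKV //.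
    by rewrite [X in _ + X]mulmx_split col_mxKu col_mxKd mulmx0 add0r !mulmxA.
  rewrite -card_F2mx -cardsT -cardsX; apply: (@card_le_inj _ _ _ _ f).
    move=> [M Z]; rewrite !inE /= andbT => /andP[/forallP Ml /eqP M0].
    apply/andP; split.
      apply/forallP=> j; rewrite ffunE lowtri_usubmx linearD /= col_mxKu addr0.
      by rewrite -lowtri_usubmx.
    have KD0 : K *m (\sum_j rsubmx (N j) *m D j) = 0.
      by rewrite mulmx_sumr; apply: big1 => j _; rewrite mulmxA KH mul0mx.
    by rewrite lincombMl fN M0 add0r mulmxA KD0 mul0mx.
  move=> [M Z] [M' Z']; rewrite !inE /= !andbT => /andP[_ /eqP M0] /andP[_ /eqP M'0] e.
  have eZ : Z = Z'.
    have : E *m lincomb N [ffun j => f (M, Z) j *m Cg j] =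
           E *m lincomb N [ffun j => f (M', Z') j *m Cg j] by rewrite e.
    by rewrite !fN M0 M'0 !add0r !mulmxA ED !mul1mx.
  congr pair => //; apply/ffunP=> j; move/ffunP/(_ j): e.
  by rewrite eZ !ffunE => /addIr.
(* The system given by [K] sees only the top blocks, so the bottom blocks contribute at most the
   number of all matrices of their shape. *)
have step2 : (#|A1| <= #|annihilating [ffun j => K *m lsubmx (N j)] Cg|
    * 2 ^ (h * m * s))%N.
  have -> : (2 ^ (h * m * s) = #|[set: {ffun 'I_s -> 'M['F_2]_(h, m)}]|)%N.
    by rewrite cardsT card_ffun card_ord card_F2mx expnM.
  pose f (M : {ffun 'I_s -> 'M['F_2]_(m + h, m)}) :=
    ([ffun j => usubmx (M j)], [ffun j => dsubmx (M j)]).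
  rewrite -cardsX; apply: (@card_le_inj _ _ _ _ f).
    move=> M; rewrite !inE /= andbT => /andP[/forallP Ml /eqP M0]; apply/andP; split.
      by apply/forallP=> j; rewrite ffunE -lowtri_usubmx.
    apply/eqP; rewrite -[RHS]M0 KN; congr lincomb; apply/ffunP=> j.
    by rewrite !ffunE -mul_usub_mx.
  move=> M M' _ _ [/ffunP eu /ffunP ed]; apply/ffunP=> j.
  have := eu j; have := ed j; rewrite !ffunE => e1 e2.
  by rewrite -(vsubmxK (M j)) e1 e2 vsubmxK.
have step3 := card_scramblings_extend s m h.
(* Rank-nullity: [\rank H] of the equations are absorbed by the free rows, and the remaining ones
   survive as [K]. *)
have er : (m * r = \rank H * m + m * \rank (kermx H))%N.
  by rewrite mxrank_ker (mulnC _ m) -mulnDr subnKC // rank_leq_row.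
rewrite er expnD mulnA.
apply: (@leq_trans (#|A1| * 2 ^ (m * \rank (kermx H)) * #|scramblings s m m|)).
  by rewrite !leq_mul2r step1 !orbT.
rewrite mulnAC (mulnC _ (2 ^ _)%N) -[X in (_ <= X)%N]mulnA leq_mul2l; apply/orP; right.
apply: leq_trans (leq_mul step2 (leqnn _)) _.
by rewrite -mulnA leq_mul2l (mulnC (2 ^ _)%N) step3 orbT.
Qed.

(** * Integer vectors as bit matrices *)

Definition bitmx (s L : nat) (V : seq (vec s)) :
    {ffun 'I_s -> 'M['F_2]_(size V, L)} :=
  [ffun j => \matrix_(a, i) (Nat.testbit (nth (zerov s) V a j) i)%:R].

Lemma testbit_above (a n : nat) : (a <= n)%N -> Nat.testbit a n = false.
Proof.
case: a => [|a] an; first exact: PeanoNat.Nat.bits_0.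
apply: PeanoNat.Nat.bits_above_log2; apply/ssrnat.ltP.
apply: leq_trans an; apply/ssrnat.ltP; apply: PeanoNat.Nat.log2_lt_lin.
exact/ssrnat.ltP.
Qed.

(** Each component is a term of the sum in [bitbound], and a number [a] has no bit at position [a]
    or above. *)
Lemma testbit_bitbound (s m n : nat) (V : seq (vec s)) (k : vec s) (j : 'I_s) :
  k \in V -> (bitbound m V <= n)%N -> Nat.testbit (k j) n = false.
Proof.
move=> kV Ln; apply/testbit_above/(leq_trans _ Ln).
rewrite /bitbound (big_rem _ kV) /= (bigD1 j) //=; lia.
Qed.

Lemma testbit_xor_seq (s n : nat) (W : seq (vec s)) (j : 'I_s) :
  (Nat.testbit (xor_seq W j) n)%:R = \sum_(w <- W) (Nat.testbit (w j) n)%:R :> 'F_2.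
Proof.
elim: W => [|w W IH]; first by rewrite big_nil ffunE PeanoNat.Nat.bits_0.
rewrite big_cons -IH /= ffunE PeanoNat.Nat.lxor_spec.
by case: (Nat.testbit (w j) n); case: (Nat.testbit _ _); rewrite /= ?addr0 ?add0r ?addrr_F2.
Qed.

(** If [V] were dependent, the full index set would drop out of the maximum, leaving only sets
    smaller than [size V]. *)
Lemma F2indep_full_rank (s : nat) (V : seq (vec s)) :
  F2rank V = size V -> F2indep V.
Proof.
move=> rV; case: (posnP (size V)) => [V0|V_gt0].
  apply/forallP=> S; apply/implyP; rewrite cards_eq0 => /set0Pn[x _].
  by have := ltn_ord x; rewrite [X in (_ < X)%N]V0.
have VE : [seq nth (zerov s) V (val i) | i in [set: 'I_(size V)]] = V.
  rewrite /image_mem enum_setT -enumT.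
  rewrite (map_comp (nth (zerov s) V) (fun i : 'I_(size V) => val i)).
  by rewrite val_enum_ord; exact: mkseq_nth.
apply/negPn/negP=> nV; have : (F2rank V <= (size V).-1)%N.
  apply/bigmax_leqP => S SV; rewrite -ltnS prednK // ltn_neqAle.
  rewrite -[X in (_ <= X)%N](card_ord (size V)) max_card andbT.
  apply: contraNN nV => /eqP cS; suff ST : S = [set: _] by rewrite ST VE in SV.
  by apply/eqP; rewrite eqEcard finset.subsetT cardsT card_ord cS leqnn.
by rewrite rV -ltnS prednK // ltnn.
Qed.

(** The support of a row vector in the left kernel selects a subset of [V] whose XOR vanishes, so
    independence forces this support to be empty. *)
Lemma rinvertible_bitmx (s m : nat) (V : seq (vec s)) :
  F2indep V -> rinvertible (bitmx (bitbound m V) V).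
Proof.
move=> /forallP Vi; apply/rinvertible_mxrow/inj_row_free => v vN.
have vNj j : v *m bitmx (bitbound m V) V j = 0.
  move/(congr1 (fun A => submxrow A j)): vN; rewrite mul_mxrow mxrowK => ->.
  by apply/matrixP=> a b; rewrite !mxE.
set S := [set i | v 0 i != 0].
case: (eqVneq #|S| 0%N) => [/eqP|S0].
  rewrite cards_eq0 => /eqP/setP S0; apply/rowP=> i; rewrite [RHS]mxE.
  by have := S0 i; rewrite !inE => /negbFE/eqP.
have /implyP/(_ S0)/negP[] := Vi S; apply/eqP/ffunP=> j; rewrite ffunE.
apply: PeanoNat.Nat.bits_inj => n; rewrite PeanoNat.Nat.bits_0.
apply/negbTE/negP => bn; have := testbit_xor_seq n
  [seq nth (zerov s) V (val i) | i in S] j.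
rewrite bn big_image /= => /eqP; rewrite (_ : \sum_(i in S) _ = 0) ?oner_eq0 //.
(* Below the bound the sum over [S] is an entry of [v *m bitmx _ V j], the nonzero coefficients of
   [v] being all [1]; from the bound on, every bit is [0]. *)
case: (ltnP n (bitbound m V)) => [nL|Ln].
  have := vNj j; move/matrixP/(_ 0 (Ordinal nL)); rewrite mxE [RHS]mxE.
  move=> vn; rewrite -[RHS]vn {vn} [RHS](bigID [in S]) /= [X in _ = _ + X]big1 ?addr0.
    apply: eq_bigr => i; rewrite inE ffunE !mxE /=.
    by case: (v 0 i) => [[|[|//]] ?] // _; rewrite -[LHS]mul1r; congr (_ * _); apply: val_inj.
  by move=> i; rewrite inE negbK => /eqP ->; rewrite mul0r.
apply: big1 => i _; rewrite (@testbit_bitbound _ m _ V) //.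
by rewrite mem_nth.
Qed.

Lemma Zall_bitmx (s m L : nat) (Cg : {ffun 'I_s -> 'M['F_2]_m})
    (M : {ffun 'I_s -> 'M['F_2]_(L, m)}) (V : seq (vec s)) :
  Zall Cg M V = (lincomb (bitmx L V) [ffun j => M j *m Cg j] == 0).
Proof.
have rowE a : row a (lincomb (bitmx L V) [ffun j => M j *m Cg j]) =
    \sum_(j < s) \sum_(i < L | Nat.testbit (nth (zerov s) V a j) i)
      row i (M j *m Cg j).
  apply/rowP=> c; rewrite mxE summxE summxE; apply: eq_bigr => j _.
  rewrite summxE !ffunE mxE [RHS]big_mkcond; apply: eq_bigr => i _.
  by rewrite [X in X * _]mxE; case: ifP => _; rewrite ?mul1r ?mul0r // [RHS]mxE.
apply/(all_nthP (zerov s))/eqP => [H|H i iV].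
  by apply/row_matrixP=> a; rewrite rowE row0; apply/eqP/H.
by have /= <- := rowE (Ordinal iV); rewrite H row0.
Qed.

(** * Union bound and density of the nonsingular matrices *)

Lemma card_bigcup_le (I : Type) (T : finType) (e : seq I) (P : pred I)
    (F : I -> {set T}) :
  (#|\bigcup_(i <- e | P i) F i| <= \sum_(i <- e | P i) #|F i|)%N.
Proof.
elim/big_rec2: _ => [|i k A _ IH]; first by rewrite cards0.
by rewrite (leq_trans (leq_card_setU _ _)) // leq_add2l.
Qed.

(* The induction needs the slack [2 / 2 ^ n]. *)
Lemma prod_pow2_sub1_lower (n : nat) :
  (0 < n)%N ->
  ((2 ^ n + 2) * 2 ^ 'C(n.+1, 2) <= 4 * 2 ^ n * \prod_(1 <= i < n.+1) (2 ^ i - 1))%N.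
Proof.
case: n => // n _; elim: n => [|n IH]; first by rewrite big_nat1.
rewrite big_nat_recr //= binS bin1 (addnC _ n.+2) expnD (expnS 2 n.+1).
move: IH; set x := (2 ^ n.+1)%N; set P := (\prod_(_ <= _ < _) _)%N.
set Q := (2 ^ 'C(_, _))%N => IH.
have x2 : (2 <= x)%N by rewrite /x expnS leq_pmulr // expn_gt0.
apply: (@leq_trans (2 * (2 * x - 1) * ((x + 2) * Q))); last first.
  apply: leq_trans (leq_mul (leqnn _) IH) _; apply/eq_leq; ring.
rewrite [leqLHS]mulnA [leqRHS]mulnA leq_mul2r; apply/orP; right; nia.
Qed.

(** The general linear group has order [2 ^ 'C(m, 2)] times the product of the [2 ^ i - 1] for
    [1 <= i <= m]; writing [m * m] as ['C(m, 2) + 'C(m.+1, 2)] leaves the preceding product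
    bound. *)
Lemma card_unitmx_F2 (m : nat) : (0 < m)%N ->
  (2 ^ (m * m) <= 4 * #|[set A : 'M['F_2]_m | A \in unitmx]|)%N.
Proof.
case: m => // m _.
have : (#|'GL_m.+1['F_2]%g| <= #|[set A : 'M['F_2]_m.+1 | A \in unitmx]|)%N.
  apply: (@card_le_inj _ _ _ _ (fun u : {'GL_m.+1['F_2]} => val u)).
    by move=> u _; rewrite inE; exact: valP u.
  by move=> u v _ _; exact: val_inj.
rewrite card_GL // card_Fp // => /(leq_mul (leqnn 4)); apply: leq_trans.
have -> : (m.+1 * m.+1 = 'C(m.+1, 2) + 'C(m.+2, 2))%N.
  elim: {+}m => // n IH; rewrite [X in (_ + X)%N]binS bin1.
  by move: IH (binS n.+1 1); rewrite bin1 => IH; nia.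
rewrite expnD mulnCA leq_mul2l; apply/orP; right.
rewrite -(leq_pmul2l (expn_gt0 2 m.+1)) mulnA (mulnC _ 4).
apply: leq_trans (prod_pow2_sub1_lower (ltn0Sn m)).
by rewrite leq_mul2r leq_addr orbT.
Qed.

Lemma card_nonsingular (s m : nat) : (0 < m)%N ->
  (2 ^ (m * m * s) <= 4 ^ s * #|nonsingular s m|)%N.
Proof.
move=> m0; have -> : #|nonsingular s m| = (#|[set A : 'M['F_2]_m | A \in unitmx]| ^ s)%N.
  rewrite -[s in (_ ^ s)%N]card_ord -card_ffun_on; apply: eq_card => C.
  rewrite inE; apply/forallP/ffun_onP => H j; first by rewrite inE.
  by have := H j; rewrite inE.
rewrite expnM -expnMn; case: (posnP s) => [->|s0]; first by rewrite !expn0.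
by rewrite leq_exp2r // card_unitmx_F2.
Qed.

(** * Reduction to finitely many systems, and the exceptional generating matrices *)

Lemma annihilating_bitmx (s m r : nat) (V : seq (vec s))
    (Cg : {ffun 'I_s -> 'M['F_2]_m}) :
  inVr r V -> Cg \in nonsingular s m ->
  exists r' (N : {ffun 'I_s -> 'M['F_2]_(r', m)}),
    [/\ (r' <= r)%N, rinvertible N, forall j, distinct_cols (N j) &
        (#|annihilating (bitmx (bitbound m V) V) Cg| * 2 ^ (m * r) *
           #|scramblings s m m|
         <= 2 ^ (m * r') * #|annihilating N Cg| *
           #|scramblings s (bitbound m V) m|)%N].
Proof.
move=> /and4P[_ _ /eqP <- /eqP rV] Cn.
have Nr := rinvertible_bitmx m (F2indep_full_rank rV).
have [r' [N1 [r'r N1r le1]]] :=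
  @annihilating_truncate s m (\sum_(k <- V) \sum_(j < s) k j) _ _ Cg Cn Nr.
have [N2 [N2r N2d le2]] := annihilating_distinct Cg N1r.
exists r', N2; split=> //; apply: leq_trans le1 _.
by rewrite leq_mul2r leq_mul2l le2 !orbT.
Qed.

(** The first two conjuncts delimit the finite family of systems over which the union bound runs. *)
Definition exceptional (s m r q : nat) (N : {ffun 'I_s -> 'M['F_2]_(r, m)})
    (Cg : {ffun 'I_s -> 'M['F_2]_m}) : bool :=
  [&& rinvertible N, [forall j, distinct_cols (N j)] &
    (q * #|scramblings s m m| <= 2 ^ (m * r) * #|annihilating N Cg|)%N].

(** Union bound over the ranks from [1] to [r], with the number of systems of each rank enlarged to
    the bound for rank [r]. *)
Lemma card_exceptional (s m r q : nat) :
  (#|[set Cg in nonsingular s m | [exists r' : 'I_r,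
      [exists N : {ffun 'I_s -> 'M['F_2]_(r'.+1, m)}, exceptional q N Cg]]]| * q
    <= r * m.+1 ^ (s * (2 ^ r - 1)) * 2 ^ (m * m * s))%N.
Proof.
pose B r' (N : {ffun 'I_s -> 'M['F_2]_(r', m)}) :=
  [set Cg in nonsingular s m |
    (q * #|scramblings s m m| <= 2 ^ (m * r') * #|annihilating N Cg|)%N].
pose P r' (N : {ffun 'I_s -> 'M['F_2]_(r', m)}) :=
  rinvertible N && [forall j, distinct_cols (N j)].
apply: (@leq_trans (#|\bigcup_(r' < r) \bigcup_(N | @P r'.+1 N) B r'.+1 N| * q)).
  rewrite leq_mul2r; apply/orP; right; apply/subset_leq_card/fintype.subsetP => Cg.
  rewrite inE => /andP[Cn /existsP[r' /existsP[N /and3P[Nr Nd le]]]].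
  apply/bigcupP; exists r' => //; apply/bigcupP; exists N; first exact/andP.
  by rewrite inE Cn.
apply: leq_trans (leq_mul (card_bigcup_le _ _ _) (leqnn q)) _.
rewrite big_distrl /= -mulnA.
apply: (@leq_trans (\sum_(r' < r) m.+1 ^ (s * (2 ^ r - 1)) * 2 ^ (m * m * s))%N);
  last by rewrite sum_nat_const card_ord.
apply: leq_sum => r' _.
apply: leq_trans (leq_mul (card_bigcup_le _ _ _) (leqnn q)) _.
rewrite big_distrl /=.
apply: (@leq_trans (\sum_(N | @P r'.+1 N) 2 ^ (m * m * s))%N).
  by apply: leq_sum => N /andP[Nr _]; exact: markov_annihilating.
rewrite sum_nat_const leq_mul2r; apply/orP; right.
apply: (@leq_trans (m.+1 ^ (s * (2 ^ r'.+1 - 1)))).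
  apply: leq_trans (card_distinct_cols s m r'.+1).
  by apply/subset_leq_card/fintype.subsetP => N; rewrite !inE => /andP[].
by rewrite leq_pexp2l // leq_mul2l leq_sub2r ?orbT // leq_pexp2l.
Qed.

(** * From counting bounds to the rank deficiency *)

Lemma PZ_bitmx (R : realType) (s m : nat) (Cg : {ffun 'I_s -> 'M['F_2]_m})
    (V : seq (vec s)) :
  PZ R Cg V = #|annihilating (bitmx (bitbound m V) V) Cg|%:R /
              #|scramblings s (bitbound m V) m|%:R.
Proof.
rewrite /PZ; congr (_%:R / _); apply: eq_card => M.
by rewrite !inE Zall_bitmx.
Qed.

(* An integrality gap of [1 / #|scramblings s m m|] keeps the supremum over the
   infinitely many [V] strictly below the threshold. *)
Lemma rank_def_exceptional (R : realType) (s m r E : nat)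
    (Cg : {ffun 'I_s -> 'M['F_2]_m}) :
  (0 < m)%N -> (0 < E)%N -> Cg \in nonsingular s m ->
  ((E%:R * log2 ((m + 1)%N%:R : R))%:E <= @rank_def R s m r Cg)%E ->
  [exists r' : 'I_r, [exists N : {ffun 'I_s -> 'M['F_2]_(r'.+1, m)},
     exceptional (m.+1 ^ E) N Cg]].
Proof.
move=> m0 E0 Cn; apply: contraTT => nex.
set S := #|scramblings s m m|.
have S0 : (0 < S)%N := card_scramblings_gt0 s m m.
pose y : R := (m.+1 ^ E)%:R - S%:R^-1.
have q2 : (2 <= m.+1 ^ E)%N.
  by rewrite (leq_trans _ (leq_pexp2l (ltn0Sn m) E0)) ?expn1.
have S0R : 0 < S%:R :> R by rewrite ltr0n.
have y0 : 0 < y.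
  rewrite /y subr_gt0 (@le_lt_trans _ _ 1) ?ltr1n //.
  by rewrite invf_le1 // ler1n.
have ln2 : 0 < ln 2 :> R by rewrite ln_gt0 // ltr1n.
have PZy V : inVr r V -> PZ R Cg V * (2 ^ (m * r))%:R <= y.
  move=> Vr; have [r' [N [r'r Nr Nd le]]] := annihilating_bitmx Vr Cn.
  have lt : (2 ^ (m * r') * #|annihilating N Cg| < m.+1 ^ E * S)%N.
    (* With no equation left, the normalised probability is at most [1], below the threshold since
       [m.+1 ^ E >= 2]; this is why exceptional ranks start at [1]. *)
    case: r' N r'r Nr Nd le => [|r'] N r'r Nr Nd _.
      rewrite muln0 mul1n (@leq_ltn_trans S) //; last first.
        by rewrite (@leq_trans (2 * S)) ?leq_mul2r ?q2 ?orbT //; lia.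
      by apply/subset_leq_card/fintype.subsetP => M; rewrite inE => /andP[].
    rewrite ltnNge; apply: contraNN nex => le.
    apply/existsP; exists (Ordinal r'r); apply/existsP; exists N.
    by apply/and3P; split=> //; apply/forallP.
  have L0 : 0 < #|scramblings s (bitbound m V) m|%:R :> R.
    by rewrite ltr0n card_scramblings_gt0.
  rewrite PZ_bitmx mulrAC ler_pdivrMr // -(ler_pM2r S0R).
  rewrite -!natrM -/S in le *.
  move: le; rewrite -(ler_nat R) => /le_trans; apply.
  rewrite natrM mulrAC ler_wpM2r ?ler0n // mulrBl mulVf ?gt_eqF //.
  by rewrite -natrM lerBrDr natr1 ler_nat.
rewrite -ltNge /rank_def.
apply: (@le_lt_trans _ _ (((m * r)%N%:R : R)%:E + (log2 y - (m * r)%:R)%:E)%E).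
  rewrite leeD2l //; apply: ge_ereal_sup => _ [V Vr <-].
  rewrite /log2e; case: ifPn => [_|PZ0]; first exact: leNye.
  have PZp : 0 < PZ R Cg V.
    by rewrite lt_def PZ0 PZ_bitmx divr_ge0 ?ler0n.
  rewrite lee_fin /log2 lerBrDr.
  have -> : (m * r)%:R = ln ((2 ^ (m * r))%:R) / ln 2 :> R.
    by rewrite natrX lnXn // -[ln 2 *+ _]mulr_natl mulfK ?gt_eqF.
  rewrite -mulrDl ler_pM2r ?invr_gt0 //.
  have p0 : 0 < (2 ^ (m * r))%:R :> R by rewrite ltr0n expn_gt0.
  by rewrite -lnM ?posrE // ler_ln ?posrE ?PZy // mulr_gt0.
rewrite -EFinD lte_fin addrC subrK /log2 addn1 mulrA ltr_pM2r ?invr_gt0 //.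
rewrite [E%:R * _]mulr_natl -lnXn ?ltr0n // -natrX ltr_ln ?posrE //.
  by rewrite /y ltrBlDr ltrDl invr_gt0.
Qed.

(** The exponent splits as [s * (2 ^ r - 1) + 2 * s * r]: the first term pays for the number of
    reduced systems, the second is the decay that remains. The [r] ranks and the density factor
    [4 ^ s] are absorbed into the exponential. *)
Lemma Prob_rank_def (R : realType) (s m r : nat)
    (A : pred {ffun 'I_s -> 'M['F_2]_m}) :
  (0 < s)%N -> (0 < m)%N -> (0 < r)%N ->
  (forall Cg, A Cg -> (((((2 ^ r + 2 * r - 1) * s)%N%:R * log2 ((m + 1)%N%:R : R))%:E
     <= @rank_def R s m r Cg)%E)) ->
  @Prob R s m A <= expR ((2 * s * r)%N%:R) / ((m + 1)%N%:R) ^+ (2 * s * r).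
Proof.
move=> s0 m0 r0 hA; set E := ((_ - 1) * s)%N in hA.
have r2 : (r < 2 ^ r)%N by exact: ltn_expl.
have E0 : (0 < E)%N by rewrite muln_gt0 s0 andbT; lia.
have EE : (E = s * (2 ^ r - 1) + 2 * s * r)%N by rewrite /E; nia.
have GLs := card_nonsingular s m0.
have GLs0 : (0 < #|nonsingular s m|)%N.
  by move: GLs; case: #|_| => //; rewrite muln0 leqn0 expn_eq0.
(* This rests on [r <= 4 ^ r.-1 <= 4 ^ (s * r.-1)], as [s] is positive. *)
have rs : (r * 4 ^ s <= 2 ^ (2 * s * r))%N.
  have -> : (2 ^ (2 * s * r) = 4 ^ (s * r.-1) * 4 ^ s)%N.
    rewrite -expnD -mulnSr prednK // -mulnA expnM //.
  rewrite leq_mul2r; apply/orP; right.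
  apply: (@leq_trans (4 ^ r.-1)); last by rewrite leq_pexp2l // leq_pmull.
  by rewrite -[X in (X <= _)%N](prednK r0) ltn_expl.
have cA : (#|[set Cg : {ffun 'I_s -> 'M['F_2]_m} |
      [forall j, Cg j \in unitmx] && A Cg]| * m.+1 ^ (2 * s * r)
    <= 2 ^ (2 * s * r) * #|nonsingular s m|)%N.
  apply: (@leq_trans (r * 4 ^ s * #|nonsingular s m|)); last by rewrite leq_mul2r rs orbT.
  apply: (@leq_trans (r * 2 ^ (m * m * s))); last by rewrite -[leqRHS]mulnA leq_mul2l GLs orbT.
  have q0 : (0 < m.+1 ^ (s * (2 ^ r - 1)))%N by rewrite expn_gt0.
  rewrite -(leq_pmul2l q0) mulnCA -expnD -EE mulnA (mulnC (_ ^ _)%N r).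
  apply: leq_trans (card_exceptional s m r (m.+1 ^ E)).
  rewrite leq_mul2r; apply/orP; right; apply/subset_leq_card/fintype.subsetP => Cg.
  rewrite inE => /andP[Cu /hA hC].
  have Cn : Cg \in nonsingular s m by rewrite inE.
  by rewrite inE Cn; exact: rank_def_exceptional hC.
rewrite /Prob -/(nonsingular s m) ler_pdivrMr ?ltr0n // mulrAC.
rewrite ler_pdivlMr ?exprn_gt0 ?ltr0n ?addn1 // -natrX -natrM.
move: cA; rewrite -(ler_nat R) => /le_trans; apply.
rewrite natrM ler_wpM2r ?ler0n // natrX -[X in expR X]mulr1 expRM_natl.
rewrite lerXn2r ?nnegrE ?expR_ge0 //.
(* [2 <= expR 1] is [1 + x <= expR x] at [x = 1]. *)
by apply: le_trans (expR_ge1Dx 1); rewrite -[2]/(1 + 1).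
Qed.

Theorem theorem9 (R : realType) (s m : nat) :
  (0 < s)%N -> (0 < m)%N ->
  @Prob R s m (fun Cg =>
      (((3 * s)%N%:R * log2 ((m + 1)%N%:R : R))%:E <= @rank_def R s m 1 Cg)%E)
    <= expR ((2 * s)%N%:R) / ((m + 1)%N%:R) ^+ (2 * s)
  /\
  (forall r : nat, (2 <= r)%N ->
     @Prob R s m (fun Cg =>
       (Order.max (@rank_def R s m r.-1 Cg)
          ((((2 ^ r + 2 * r - 1) * s)%N%:R * log2 ((m + 1)%N%:R : R))%:E)
        <= @rank_def R s m r Cg)%E)
     <= expR ((2 * s * r)%N%:R) / ((m + 1)%N%:R) ^+ (2 * s * r)).
Proof.
move=> s0 m0; split.
  (* At [r = 1] the coefficient [2 ^ r + 2 * r - 1] evaluates to [3]. *)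
  by rewrite -[(2 * s)%N]muln1; exact: (@Prob_rank_def R s m 1).
move=> r r2; apply: Prob_rank_def => // [|Cg]; first exact: ltnW.
by rewrite ge_max => /andP[].
Qed.
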